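(* Let $f:\mathbb{R}^d\to\mathbb{R}$ be differentiable, $L$-smooth ($L>0$) and $\mu$-strongly convex ($\mu>0$), with unique minimizer $\theta^*$. Let $\mathcal{D}$ be a probability distribution on $\mathbb{R}^d$ such that (i) $\mathbb{E}_{s\sim\mathcal{D}}[\|s\|_2^2]<\infty$; (ii) there is a constant $\mu_{\mathcal{D}}>0$ with $\mathbb{E}_{s\sim\mathcal{D}}|\langle v,s\rangle|\ge\mu_{\mathcal{D}}\|v\|_2$ for all $v\in\mathbb{R}^d$; (iii) $\mathbb{P}_{s\sim\mathcal{D}}(\|s\|_2\le1)=1$; (iv) $\mu_{\mathcal{D}}<1$. Let $h\in\left(\frac{1}{\sqrt{1-\frac{\mu_{\mathcal{D}}^2\mu}{L}}},\infty\right)$ and let $\{\theta^t\}_{t\ge1}$ be generated by the Stochastic Three Points (STP) algorithm with step sizes $\alpha_t=\frac{|f(\theta^t+h^{-t}s_t)-f(\theta^t)|}{Lh^{-t}}$. Then for all $T\ge2$, $$\mathbb{E}[f(\theta^T)-f(\theta^* )]\le\left(1-\frac{\mu_{\mathcal{D}}^2\mu}{L}\right)^{T-1}\left[f(\theta^1)-f(\theta^* )+\frac L8\,\frac{1}{h^2\left(1-\frac{\mu_{\mathcal{D}}^2\mu}{L}\right)-1}\right].$$ In particular, if $\mu_{\mathcal{D}}=\frac{K}{\sqrt d}$ for some constant $K>0$ and $h=\frac{2}{\sqrt{1-\frac{\mu_{\mathcal{D}}^2\mu}{L}}}$, then $\mathbb{E}[f(\theta^T)-f(\theta^* )]=O\left(\left(1-\frac{\mu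 K^2}{dL}\right)^T\right)$ as $T\to\infty$.
   Context: $L$-smooth means $\|\nabla f(x)-\nabla f(y)\|_2\le L\|x-y\|_2$ for all $x,y\in\mathbb{R}^d$. $\mu$-strongly convex means $f(y)\ge f(x)+\langle\nabla f(x),y-x\rangle+\frac\mu2\|y-x\|_2^2$ for all $x,y\in\mathbb{R}^d$. STP algorithm: given a deterministic initial point $\theta^1\in\mathbb{R}^d$ and the distribution $\mathcal{D}$, for $t=1,2,\ldots$ draw a random vector $s_t\sim\mathcal{D}$ (the $s_t$ being independent), compute the step size $\alpha_t$ (which here depends on $\theta^t$ and $s_t$), and set $\theta^{t+1}\in\arg\min_{\theta\in\{\theta^t,\ \theta^t+\alpha_ts_t,\ \theta^t-\alpha_ts_t\}}f(\theta)$, with ties broken by a fixed measurable rule depending only on $(t,\theta^t,s_t)$. *)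

(* Defs.v *)
(* Written for MathComp and MathComp-Analysis, over an abstract [R : realType]. *)
From HB Require Import structures.
From mathcomp Require Export all_boot all_order all_algebra finmap.
From mathcomp Require Export all_classical all_reals all_analysis.
Export numFieldNormedType.Exports.
Export Order.TTheory GRing.Theory Num.Theory.

Set Implicit Arguments.
Unset Strict Implicit.
Unset Printing Implicit Defensive.

Local Open Scope classical_set_scope.
Local Open Scope ring_scope.

(* The Borel sigma-algebra of R^d. The topology of ['rV[R]_d] comes from the sup
   norm, so its open sets are those of the Euclidean norm. *)
HB.instance Definition _ (R : realType) (d : nat) :=
  Measurable.copy 'rV[R]_d (g_sigma_algebraType (@open 'rV[R]_d)).

Section Euclidean.
Context {R : realType} {d : nat}.
Implicit Types (u v x y : 'rV[R]_d) (f : 'rV[R]_d -> R).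

Definition dotp u v : R := \sum_(i < d) u 0 i * v 0 i.

(* [`|v|] is the sup norm on ['rV[R]_d], hence a separate Euclidean norm. *)
Definition norm2 v : R := Num.sqrt (dotp v v).

Definition grad f x : 'rV[R]_d := \row_(i < d) 'D_(delta_mx 0 i) f x.

Definition smooth (L : R) f : Prop :=
  forall x y, norm2 (grad f x - grad f y) <= L * norm2 (x - y).

Definition strongly_convex (mu : R) f : Prop :=
  forall x y, f x + dotp (grad f x) (y - x) + mu / 2 * norm2 (y - x) ^+ 2 <= f y.

End Euclidean.

Definition argmin {T : Type} {R : realType} (f : T -> R) (A : set T) : set T :=
  [set x | A x /\ forall y, A y -> f x <= f y].

Definition mutually_independent {d d'} {Omega : measurableType d}
    {T : measurableType d'} {R : realType} (P : probability Omega R)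
    {I : choiceType} (K : set I) (X : I -> {RV P >-> T}) : Prop :=
  forall (J : {fset I}) (A : I -> set T),
    [set` J] `<=` K ->
    (forall i, measurable (A i)) ->
    P (\bigcap_(i in [set` J]) (X i @^-1` A i)) =
    (\prod_(i <- J) P (X i @^-1` A i))%E.

Section STP.
Context {R : realType} {d : nat} {d' : measure_display}.
Context {Omega : measurableType d'} (P : probability Omega R).
Local Notation V := 'rV[R]_d.

(* [next t x s] is the point selected at iteration t from the current iterate x
   and the direction s; it encodes the tie-breaking rule. *)
Definition STP_selection (f : V -> R) (alpha : nat -> V -> V -> R)
    (next : nat -> V -> V -> V) : Prop :=
  forall t, (1 <= t)%N ->
    measurable_fun [set: V * V] (fun p => next t p.1 p.2) /\
    forall x s, argmin f
      [set x; x + alpha t x s *: s; x - alpha t x s *: s] (next t x s).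

(* Time starts at 1: [s 0] and [theta 0] are unconstrained and never used. *)
Record STP (f : V -> R) (D : probability V R) (alpha : nat -> V -> V -> R)
    (theta1 : V) (s : nat -> {RV P >-> V}) (theta : nat -> Omega -> V) : Prop :=
  { STP_distr : forall t, (1 <= t)%N ->
      forall A : set V, measurable A -> distribution P (s t) A = D A
  ; STP_indep : mutually_independent [set t | (1 <= t)%N] s
  ; STP_init : forall w, theta 1 w = theta1
  ; STP_step : exists2 next, STP_selection f alpha next &
      forall t, (1 <= t)%N ->
        forall w, theta t.+1 w = next t (theta t w) (s t w) }.

End STP.

Definition stepsize {R : realType} {d : nat} (f : 'rV[R]_d -> R) (L h : R)
    (t : nat) (x s : 'rV[R]_d) : R :=
  `|f (x + h ^- t *: s) - f x| / (L * h ^- t).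

(* Main.v *)
From HB Require Import structures.
Require Import Defs.
From mathcomp Require Import ring lra measurable_realfun.

(* Write F = f - f(xstar), g = grad f and r = h^-t. Convexity and the descent
   lemma give <g(x), s> <= (f(x + r s) - f(x)) / r <= <g(x), s> + L r / 2 when
   |s| <= 1, so moving by alpha_t along the better of s and -s lowers f by at
   least <g(x), s>^2 / (2 L) - L r^2 / 8. Averaging over s, Jensen's inequality
   with the spread condition and then the Polyak-Lojasiewicz inequality
   |g|^2 >= 2 mu F give E[F(theta^(t+1)) | theta^t] <= rho F(theta^t) + L r^2 / 8.
   Conditioning is a Fubini argument, because theta^t is independent of s_t.
   Unrolling the recursion yields a geometric series of ratio 1 / (h^2 rho). *)

Set Implicit Arguments.
Unset Strict Implicit.
Unset Printing Implicit Defensive.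

Local Open Scope classical_set_scope.
Local Open Scope ring_scope.

(** * Euclidean inner product and norm, and Borel measurability on row vectors *)

Section DotProduct.
Context {R : realType} {d : nat}.
Implicit Types (u v w : 'rV[R]_d) (a : R).

Lemma dotpC u v : dotp u v = dotp v u.
Proof. by apply: eq_bigr => i _; rewrite mulrC. Qed.

Lemma dotpDr u v w : dotp u (v + w) = dotp u v + dotp u w.
Proof. by rewrite -big_split; apply: eq_bigr => i _; rewrite mxE mulrDr. Qed.

Lemma dotpZr a u v : dotp u (a *: v) = a * dotp u v.
Proof. by rewrite mulr_sumr; apply: eq_bigr => i _; rewrite mxE mulrCA. Qed.

Lemma dotpDl u v w : dotp (v + w) u = dotp v u + dotp w u.
Proof. by rewrite dotpC dotpDr !(dotpC u). Qed.

Lemma dotpZl a u v : dotp (a *: u) v = a * dotp u v.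
Proof. by rewrite dotpC dotpZr dotpC. Qed.

Lemma dotpNr u v : dotp u (- v) = - dotp u v.
Proof. by rewrite -scaleN1r dotpZr mulN1r. Qed.

Lemma dotpNl u v : dotp (- u) v = - dotp u v.
Proof. by rewrite dotpC dotpNr dotpC. Qed.

Definition dotpE := (dotpDl, dotpDr, dotpNl, dotpNr, dotpZl, dotpZr).

Lemma dotpp_ge0 u : 0 <= dotp u u.
Proof. by apply: sumr_ge0 => i _; rewrite -expr2 sqr_ge0. Qed.

Lemma norm2_ge0 u : 0 <= norm2 u. Proof. exact: sqrtr_ge0. Qed.

Lemma sqr_norm2 u : norm2 u ^+ 2 = dotp u u.
Proof. by rewrite sqr_sqrtr // dotpp_ge0. Qed.

Lemma norm2Z a u : norm2 (a *: u) = `|a| * norm2 u.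
Proof. by rewrite /norm2 !dotpE mulrA -expr2 sqrtrM ?sqr_ge0 // sqrtr_sqr. Qed.

Lemma norm2_delta (i : 'I_d) : norm2 (delta_mx 0 i : 'rV[R]_d) = 1.
Proof.
rewrite /norm2 /dotp (bigD1 i) //= !mxE !eqxx big1 ?addr0 ?mulr1 ?sqrtr1 //.
by move=> j /negbTE ji; rewrite !mxE eqxx ji mul0r.
Qed.

Lemma norm2_eq0 u : norm2 u = 0 -> u = 0.
Proof.
move=> /eqP; rewrite sqrtr_eq0 => u0; apply/rowP => i; rewrite mxE.
have {}u0 : dotp u u = 0 by apply/eqP; rewrite eq_le u0 dotpp_ge0.
have /eqP := psumr_eq0P (fun j _ => sqr_ge0 (u 0 j)) u0 (i := i) isT.
by rewrite sqrf_eq0 => /eqP.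
Qed.

(** Cauchy-Schwarz: the square of [norm2 v *: u - norm2 u *: v] is nonnegative and equals
    [2 |u| |v| (|u| |v| - <u, v>)]. Zero vectors are treated apart so that [|u| |v|] can be
    cancelled. *)
Lemma dotp_le_norm2 u v : dotp u v <= norm2 u * norm2 v.
Proof.
have dotp0 w : dotp 0 w = 0 by rewrite -(scale0r 0) dotpZl mul0r.
have [/norm2_eq0 ->|u0] := eqVneq (norm2 u) 0.
  by rewrite dotp0 mulr_ge0 // norm2_ge0.
have [/norm2_eq0 ->|v0] := eqVneq (norm2 v) 0.
  by rewrite dotpC dotp0 mulr_ge0 // norm2_ge0.
have := dotpp_ge0 (norm2 v *: u - norm2 u *: v).
rewrite !dotpE -!sqr_norm2 (dotpC v u).
have {}u0 : 0 < norm2 u by rewrite lt_def u0 norm2_ge0.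
have {}v0 : 0 < norm2 v by rewrite lt_def v0 norm2_ge0.
move=> H; rewrite -subr_ge0 -(pmulr_rge0 _ (mulr_gt0 u0 v0)).
by lra.
Qed.

Lemma continuous_dotp u : continuous (dotp u).
Proof.
apply: continuous_big; first exact: add_continuous.
move=> i _ x; apply: (@continuousM _ _ (fun=> u 0 i) (fun v => v 0 i)).
  exact: cst_continuous.
exact: coord_continuous.
Qed.

Lemma continuous_norm2 : continuous (@norm2 R d).
Proof.
move=> x; apply: (@continuous_comp _ _ _ (fun v => dotp v v) Num.sqrt); last first.
  exact: sqrt_continuous.
have : continuous (fun v : 'rV[R]_d => dotp v v); last exact.
apply: continuous_big; first exact: add_continuous.
move=> i _ {}x; apply: (@continuousM _ _ (fun v => v 0 i) (fun v => v 0 i)).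
  exact: coord_continuous.
exact: coord_continuous.
Qed.

(** Open intervals generate the Borel sets of the line, and their preimages under [g] are open,
    hence among the generators of the source sigma-algebra. *)
Lemma continuous_measurable_rV (g : 'rV[R]_d -> R) :
  continuous g -> measurable_fun [set: 'rV[R]_d] g.
Proof.
move=> /continuousP cg; apply: (measurability _ (RGenOpens.measurableE R)).
move=> _ [_ [a [b ->] <-]]; rewrite setTI.
apply: sub_sigma_algebra; apply: cg; exact: interval_open.
Qed.

End DotProduct.

(** * Deterministic consequences of smoothness and strong convexity *)

Section Landscape.
Context {R : realType} {d : nat}.
Variables (f : 'rV[R]_d -> R) (L mu : R).
Hypothesis (f_smooth : smooth L f) (f_sconvex : strongly_convex mu f).
Hypothesis (L_gt0 : 0 < L) (mu_gt0 : 0 < mu).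
Implicit Types x y v s : 'rV[R]_d.

Lemma convex_lower_bound x y : f x + dotp (grad f x) (y - x) <= f y.
Proof.
apply: le_trans (f_sconvex x y).
by rewrite lerDl mulr_ge0 ?sqr_ge0 // divr_ge0 // ltW.
Qed.

Lemma grad_lipschitz_along x v (a : R) : 0 <= a ->
  dotp (grad f (x + a *: v) - grad f x) v <= L * a * dotp v v.
Proof.
move=> a0; apply: le_trans (dotp_le_norm2 _ _) _.
have := f_smooth (x + a *: v) x.
rewrite (addrC x) addrK norm2Z ger0_norm // => H.
by rewrite -sqr_norm2 expr2 !mulrA -(mulrA L) ler_wpM2r // norm2_ge0.
Qed.

(* Summing the gradient inequality at the n subdivision points of [x, x + v]
   gives the constant [(n + 1) / (2 n)], which tends to [1 / 2]. *)
Lemma descent_subdivision x v (n : nat) : (0 < n)%N ->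
  f (x + v) <= f x + dotp (grad f x) v + L * dotp v v * (n.+1%:R / (2 * n%:R)).
Proof.
move=> n0; have nR : 0 < n%:R :> R by rewrite ltr0n.
have step (k : nat) : f (x + (k%:R / n%:R) *: v) <=
    f x + k%:R / n%:R * dotp (grad f x) v
      + L * dotp v v / n%:R ^+ 2 * (k%:R * k.+1%:R / 2).
  elim: k => [|k IH]; first by rewrite !mul0r scale0r mulr0 !addr0.
  (* Convexity is applied at the right endpoint looking back, so the increments involve the
     gradients at indices 1, ..., k, whose indices sum to [k (k + 1) / 2]. *)
  have := convex_lower_bound (x + (k.+1%:R / n%:R) *: v) (x + (k%:R / n%:R) *: v).
  have -> : x + (k%:R / n%:R) *: v - (x + (k.+1%:R / n%:R) *: v) = - (n%:R^-1 *: v).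
    rewrite opprD addrACA subrr add0r -scalerBl -[RHS]scaleNr -natr1; congr (_ *: _).
    by field; rewrite gt_eqF.
  have := @grad_lipschitz_along x v (k.+1%:R / n%:R) _.
  rewrite divr_ge0 ?ler0n // => /(_ isT).
  have k1 : k.+1%:R = k%:R + 1 :> R by rewrite natr1.
  have k2 : k.+2%:R = k%:R + 1 + 1 :> R by rewrite !natr1.
  rewrite dotpDl !dotpNl dotpNr dotpZr; move: IH; rewrite k2 k1.
  set a := f _; set b := f (x + ((_ + 1) / _) *: v); set p := dotp (grad f x) v.
  set q := dotp (grad f (_ + _)) v; set w := dotp v v.
  move=> H1 H2 H3.
  have : (q - p) / n%:R <= L * ((k%:R + 1) / n%:R) * w / n%:R.
    by rewrite ler_pM2r ?invr_gt0.
  rewrite expr2 invfM in H1 *.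
  by lra.
have := step n; rewrite divff ?gt_eqF // scale1r mul1r => /le_trans -> //.
by rewrite lerD2l le_eqVlt; apply/orP; left; apply/eqP; field; rewrite gt_eqF.
Qed.

Lemma descent x v : f (x + v) <= f x + dotp (grad f x) v + L / 2 * dotp v v.
Proof.
have C0 : 0 <= L * dotp v v / 2 by rewrite divr_ge0 // mulr_ge0 ?dotpp_ge0 // ltW.
apply/ler_addgt0Pr => e e0.
(* The excess of the subdivision bound over the limit is [L |v|^2 / (2 n)]; this [n] makes it at
   most [e]. *)
set n := (Num.truncn (L * dotp v v / 2 / e)).+1.
have nR : 0 < n%:R :> R by rewrite ltr0n.
have := @descent_subdivision x v n isT; move/le_trans; apply.
have -> : L * dotp v v * (n.+1%:R / (2 * n%:R)) =
    L / 2 * dotp v v + L * dotp v v / 2 / n%:R.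
  by rewrite -natr1; field; rewrite gt_eqF.
have : L * dotp v v / 2 / n%:R <= e; last by lra.
by rewrite ler_pdivrMr // (mulrC e) -ler_pdivrMr // ltW // truncnS_gt.
Qed.

(** Adding strong convexity from 0 to a unit vector [e] and back gives [mu <= <g(e) - g(0), e>],
    which smoothness bounds by [L]. Positivity of [d] supplies [e]; the result later makes [rho]
    positive. *)
Lemma mu_le_L : (0 < d)%N -> mu <= L.
Proof.
case: d f f_smooth f_sconvex => // n g gs gc _.
pose e : 'rV[R]_n.+1 := delta_mx 0 0.
have e1 : norm2 e ^+ 2 = 1 by rewrite norm2_delta expr1n.
have := gc 0 e; have := gc e 0; rewrite subr0 sub0r -scaleN1r norm2Z.
rewrite normrN1 mul1r e1 !dotpE.
have := dotp_le_norm2 (grad g e - grad g 0) e.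
have := gs e 0; rewrite subr0 !dotpE norm2_delta; lra.
Qed.

(** With [z = y - x], strong convexity multiplied by [2 mu] bounds the left side by
    [|g|^2 - |g + mu z|^2]. *)
Lemma polyak_lojasiewicz x y : 2 * mu * (f x - f y) <= norm2 (grad f x) ^+ 2.
Proof.
have := f_sconvex x y; move: (y - x) => z.
have := dotpp_ge0 (grad f x + mu *: z); rewrite !sqr_norm2 !dotpE (dotpC z) => H1 H2.
have := ler_wpM2l (ltW mu_gt0) H2.
by lra.
Qed.

Lemma three_points_decrease x s z (r : R) : 0 < r -> norm2 s <= 1 ->
  let alpha := `|f (x + r *: s) - f x| / (L * r) in
  argmin f [set x; x + alpha *: s; x - alpha *: s] z ->
  f z + dotp (grad f x) s ^+ 2 / (2 * L) <= f x + L * r ^+ 2 / 8.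
Proof.
move=> r0 s1 alpha [_ zmin].
have ss : dotp s s <= 1 by rewrite -sqr_norm2 expr_le1 // norm2_ge0.
have ss0 := dotpp_ge0 s.
(* [D] is the finite-difference slope along [s], so that [alpha = |D| / L]; it overestimates the
   true slope [a] by at most [L r / 2]. *)
set a := dotp (grad f x) s; set D := (f (x + r *: s) - f x) / r.
have aD : a <= D.
  rewrite ler_pdivlMr //; have := convex_lower_bound x (x + r *: s).
  by rewrite (addrC x) addrK dotpZr -/a addrC -lerBrDr; lra.
have Da : D <= a + L * r / 2.
  rewrite ler_pdivrMr //; have := descent x (r *: s).
  rewrite !dotpE -/a => H.
  have : L / 2 * (r * (r * dotp s s)) <= L / 2 * (r * r).
    do 2![apply: ler_wpM2l; first by rewrite ?divr_ge0 ?ltW].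
    by apply: ler_piMr; first exact: ltW.
  by lra.
have alphaE : alpha = `|D| / L.
  by rewrite /alpha /D normrM normfV (gtr0_norm r0) invfM mulrA mulrAC.
have alpha0 : 0 <= alpha by rewrite alphaE divr_ge0 // ltW.
(* Only [b ^+ 2] enters the quadratic term, so one bound serves both signs of the step. *)
have up (b : R) : b ^+ 2 = alpha ^+ 2 -> f z <= f (x + b *: s) ->
    f z <= f x + b * a + L / 2 * alpha ^+ 2.
  move=> b2 /le_trans; apply; apply: (le_trans (descent x _)).
  rewrite !dotpE -/a lerD2l ler_pM2l ?divr_gt0 // mulrA -expr2 b2.
  by rewrite ler_piMr // sqr_ge0.
have up1 := up _ erefl (zmin (x + alpha *: s) (or_introl (or_intror erefl))).
have up2 := up (- alpha) (sqrrN _) _.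
have {}up2 : f z <= f x + - alpha * a + L / 2 * alpha ^+ 2.
  by apply: up2; rewrite scaleNr; apply: zmin; right.
have La : L * alpha = `|D| by rewrite alphaE mulrCA divff ?mulr1 // gt_eqF.
(* Stepping against the sign of [D] changes [2 L f] by at most [D^2 - 2 D a = (D - a)^2 - a^2],
   where [0 <= D - a <= L r / 2]. Dividing by [2 L] produces the error [L r^2 / 8]. *)
have key : 2 * L * f z + a ^+ 2 <= 2 * L * f x + (L * r / 2) ^+ 2.
  have Lf c : f z <= c -> 2 * L * f z <= 2 * L * c.
    by move=> H; rewrite ler_pM2l // mulr_gt0.
  have LL (c : R) : 2 * L * (f x + c * alpha * a + L / 2 * alpha ^+ 2) =
      2 * L * f x + 2 * c * (L * alpha) * a + (L * alpha) ^+ 2 by field.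
  move: (Lf _ up1) (Lf _ up2).
  rewrite -mulN1r -{1}(mul1r alpha) !LL La real_normK ?num_real //.
  by case: (ger0P D) => D0; nra.
rewrite -(ler_pM2l (_ : 0 < 2 * L)) ?mulr_gt0 //.
have -> : 2 * L * (f z + a ^+ 2 / (2 * L)) = 2 * L * f z + a ^+ 2.
  by field; rewrite gt_eqF.
by apply: le_trans key _; lra.
Qed.

End Landscape.

(** * Expectations of nonnegative variables *)

Section Expectation.
Context {disp : measure_display} {T : measurableType disp} {R : realType}.
Variable P : probability T R.
Implicit Types X Y : T -> R.

Lemma expectationE X : ('E_P[X] = \int[P]_w (X w)%:E)%E.
Proof. by rewrite unlock. Qed.

(** Nonnegativity takes the place of integrability, so the gap may a priori have infinite
    expectation. *)
Lemma ge0_expectationD X Y :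
  measurable_fun [set: T] X -> measurable_fun [set: T] Y ->
  (forall w, 0 <= X w) -> (forall w, 0 <= Y w) ->
  ('E_P[fun w => (X w + Y w)%R] = 'E_P[X] + 'E_P[Y])%E.
Proof.
move=> mX mY X0 Y0; rewrite !expectationE.
under eq_integral do rewrite EFinD.
by rewrite ge0_integralD //; do ?[by move=> w _; rewrite lee_fin|exact/measurable_EFinP].
Qed.

Lemma ge0_expectationZl X (c : R) :
  measurable_fun [set: T] X -> (forall w, 0 <= X w) -> 0 <= c ->
  ('E_P[fun w => (c * X w)%R] = c%:E * 'E_P[X])%E.
Proof.
move=> mX X0 c0; rewrite !expectationE.
under eq_integral do rewrite EFinM.
by rewrite ge0_integralZl //; do ?[by move=> w _; rewrite lee_fin|exact/measurable_EFinP].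
Qed.

(** The comparison is asked only on an event of probability one because the one-step decrease holds
    only for directions in the unit ball. *)
Lemma expectation_ae_le X Y (A : set T) :
  measurable A -> P A = 1%E ->
  measurable_fun [set: T] X -> measurable_fun [set: T] Y ->
  (forall w, 0 <= X w) -> (forall w, 0 <= Y w) ->
  (forall w, A w -> X w <= Y w) -> ('E_P[X] <= 'E_P[Y])%E.
Proof.
move=> mA PA mX mY X0 Y0 XY; rewrite !expectationE.
apply: ae_ge0_le_integral => //;
  do ?[by move=> w _; rewrite lee_fin|exact/measurable_EFinP].
exists (~` A); split; first exact: measurableC.
  by have := probability_setC P mA; rewrite PA subee.
by move=> w /= nXY Aw; apply: nXY => _; rewrite lee_fin; exact: XY.
Qed.

(* [0 <= (|X| - c) ^ 2] bounds the second moment with no integrability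
   assumption on X. *)
Lemma sqr_le_second_moment X (c : R) : measurable_fun [set: T] X -> 0 <= c ->
  (c%:E <= 'E_P[fun w => `|X w|%R])%E ->
  ((c ^+ 2)%:E <= 'E_P[fun w => (X w ^+ 2)%R])%E.
Proof.
move=> mX c0 cX.
have mN : measurable_fun setT (fun w => `|X w|) by exact: measurableT_comp.
have m2 : measurable_fun setT (fun w => X w ^+ 2) by exact: measurable_funX.
have : ('E_P[fun w => (2 * c * `|X w|)%R] <= 'E_P[fun w => (X w ^+ 2 + c ^+ 2)%R])%E.
  apply: (@expectation_ae_le _ _ setT) => //.
  - exact: probability_setT.
  - exact: measurable_funM.
  - exact: measurable_funD.
  - by move=> w; rewrite !mulr_ge0.
  - by move=> w; rewrite addr_ge0 ?sqr_ge0.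
  move=> w _; rewrite -(real_normK (num_real (X w))).
  by have := sqr_ge0 (`|X w| - c); lra.
rewrite ge0_expectationZl ?mulr_ge0 // ge0_expectationD //;
  do ?by move=> w; exact: sqr_ge0.
rewrite (_ : 'E_P[fun=> (c ^+ 2)%R] = (c ^+ 2)%:E)%E; last exact: expectation_cst.
have H : ((2 * c * c)%:E <= (2 * c)%:E * 'E_P[fun w => `|X w|%R])%E.
  by rewrite EFinM lee_wpmul2l // lee_fin mulr_ge0.
move=> /(le_trans H); rewrite -leeBlDr // -EFinB; apply: le_trans.
by rewrite lee_fin; lra.
Qed.

End Expectation.

(** * Expected decrease in one iteration from a fixed point *)

Section ConditionalDecrease.
Context {R : realType} {d : nat}.
Local Notation V := 'rV[R]_d.
Variables (f : V -> R) (L mu : R) (xstar : V).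
Hypothesis f_smooth : smooth L f.
Hypothesis f_sconvex : strongly_convex mu f.
Hypothesis f_cont : continuous f.
Hypotheses (L_gt0 : 0 < L) (mu_gt0 : 0 < mu).
Hypothesis f_min : forall x, f xstar <= f x.
Variables (D : probability V R) (muD : R).
Hypothesis muD_gt0 : 0 < muD.
Hypothesis D_spread :
  forall v, ((muD * norm2 v)%:E <= 'E_D[fun s => `|dotp v s|%R])%E.
Hypothesis D_bounded : D [set s | norm2 s <= 1] = 1%E.

Lemma measurable_unit_ball : measurable [set s : V | norm2 s <= 1].
Proof.
have := continuous_measurable_rV (@continuous_norm2 R d) measurableT
  (measurable_itv `]-oo, 1]).
by rewrite setTI; congr measurable; apply/seteqP; split => x /=; rewrite in_itv.
Qed.

Lemma conditional_decrease (x : V) (sel : V -> V) (r : R) : 0 < r ->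
  measurable_fun [set: V] sel ->
  (forall s, let alpha := `|f (x + r *: s) - f x| / (L * r) in
     argmin f [set x; x + alpha *: s; x - alpha *: s] (sel s)) ->
  ('E_D[fun s => (f (sel s) - f xstar)%R] <=
     ((1 - muD ^+ 2 * mu / L) * (f x - f xstar) + L * r ^+ 2 / 8)%:E)%E.
Proof.
move=> r0 msel selmin.
have mf := continuous_measurable_rV f_cont.
have mg : measurable_fun setT (fun s => f (sel s) - f xstar).
  by apply: measurable_funB => //; exact: measurableT_comp.
have md : measurable_fun setT (dotp (grad f x)).
  by apply: continuous_measurable_rV; exact: continuous_dotp.
have m2 : measurable_fun setT (fun s => dotp (grad f x) s ^+ 2).
  exact: measurable_funX.
have fx0 : 0 <= f x - f xstar by rewrite subr_ge0.
have c0 : 0 <= L * r ^+ 2 / 8 by rewrite divr_ge0 // mulr_ge0 ?sqr_ge0 // ltW.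
have L0 : 0 <= (2 * L)^-1 by rewrite invr_ge0 mulr_ge0 // ltW.
(* The squared slope is kept on the left so that both integrands are nonnegative. *)
have : ('E_D[fun s => ((f (sel s) - f xstar) + (2 * L)^-1 * dotp (grad f x) s ^+ 2)%R] <=
    'E_D[fun=> ((f x - f xstar) + L * r ^+ 2 / 8)%R])%E.
  apply: (expectation_ae_le measurable_unit_ball D_bounded) => //.
  - by apply: measurable_funD => //; exact: measurable_funM.
  - by move=> s; rewrite addr_ge0 ?subr_ge0 // mulr_ge0 ?sqr_ge0.
  - by move=> s; rewrite addr_ge0.
  move=> s /= s1.
  by have := three_points_decrease f_smooth f_sconvex L_gt0 mu_gt0 r0 s1 (selmin s); lra.
rewrite [leRHS](_ : _ = ((f x - f xstar) + L * r ^+ 2 / 8)%:E); last first.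
  exact: expectation_cst.
rewrite ge0_expectationD //; last 3 first.
- exact: measurable_funM.
- by move=> s; rewrite subr_ge0.
- by move=> s; rewrite mulr_ge0 ?sqr_ge0.
rewrite ge0_expectationZl //; last by move=> s; exact: sqr_ge0.
move=> H.
(* The second moment of the slope is at least [(muD |g|)^2], and Polyak-Lojasiewicz at [xstar] turns
   this into [muD^2 * 2 mu / (2 L)], the contraction [1 - rho], times the gap. *)
have lower : ((muD ^+ 2 * mu / L * (f x - f xstar))%:E <=
    (2 * L)^-1%:E * 'E_D[fun s => (dotp (grad f x) s ^+ 2)%R])%E.
  have : ((2 * L)^-1%:E * ((muD * norm2 (grad f x)) ^+ 2)%:E <=
      (2 * L)^-1%:E * 'E_D[fun s => (dotp (grad f x) s ^+ 2)%R])%E.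
    apply: lee_wpmul2l; first by rewrite lee_fin.
    by apply: sqr_le_second_moment => //; rewrite mulr_ge0 ?norm2_ge0 // ltW.
  apply: le_trans; rewrite -EFinM lee_fin exprMn.
  have /(ler_wpM2l (sqr_ge0 muD)) := polyak_lojasiewicz f_sconvex mu_gt0 x xstar.
  move=> /(ler_wpM2l L0); apply: le_trans.
  by rewrite le_eqVlt; apply/orP; left; apply/eqP; field; rewrite gt_eqF.
have {lower} := le_trans (leeD2l _ lower) H.
rewrite -leeBrDr // -EFinB => /le_trans; apply.
by rewrite lee_fin; lra.
Qed.

End ConditionalDecrease.

(** * Independence and Tonelli for a pair of random variables *)

Section PairIndependence.
Context {disp d1 d2 : measure_display} {Omega : measurableType disp}.
Context {T1 : measurableType d1} {T2 : measurableType d2} {R : realType}.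
Variable P : probability Omega R.
Variables (X : {RV P >-> T1}) (Y : {RV P >-> T2}).

Let measurable_pair : measurable_fun [set: Omega] (fun w => (X w, Y w)).
Proof. exact: measurable_fun_pair. Qed.

(** Both sides are finite measures in [C]: the law of the pair under [P] restricted to [E], and its
    law under [P] scaled by [P E]. They agree on rectangles, a generating family stable under
    intersection, hence everywhere. *)
Lemma pair_independent_event (E : set Omega) : measurable E ->
  (forall A B, measurable A -> measurable B ->
    P ((X @^-1` A `&` Y @^-1` B) `&` E) = (P (X @^-1` A `&` Y @^-1` B) * P E)%E) ->
  forall C : set (T1 * T2), measurable C ->
    P ((fun w => (X w, Y w)) @^-1` C `&` E) =
    (P ((fun w => (X w, Y w)) @^-1` C) * P E)%E.
Proof.
move=> mE rect C mC.
have pE : 0 <= fine (P E) by rewrite fine_ge0.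
pose m1 : {measure set (T1 * T2) -> \bar R} :=
  pushforward (mrestr P mE) (fun w => (X w, Y w)).
pose m2 : {measure set (T1 * T2) -> \bar R} :=
  mscale (NngNum pE) (pushforward P (fun w => (X w, Y w))).
have pK : (fine (P E))%:E = P E by rewrite fineK ?fin_num_measure.
rewrite muleC -pK; apply: (@measure_unique _ _ _
  [set A `*` B | A in measurable & B in measurable] (fun=> setT) _ _ _ _
  (m1 measurable_pair) (m2 measurable_pair) _ _ C mC).
- exact: measurable_prod_measurableType.
- move=> _ _ [A mA [B mB <-]] [A' mA' [B' mB' <-]].
  exists (A `&` A'); first exact: measurableI.
  by exists (B `&` B'); [exact: measurableI|rewrite setXI].
- by move=> _; exists setT => //; exists setT => //; rewrite setXTT.
- by apply/seteqP; split => // x _; exists 0%N.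
- by move=> _ [A mA [B mB <-]]; rewrite /= /mscale /= pK muleC; exact: rect.
- move=> _; apply: (@le_lt_trans _ _ 1%E); last exact: ltry.
  by rewrite /= /pushforward /mrestr preimage_setT setTI; exact: probability_le1.
Qed.

(** Independence makes the joint law the product of its marginals, after which Tonelli integrates
    the second variable first. *)
Lemma ge0_integral_pair (D : probability T2 R) (g : T1 * T2 -> \bar R) :
  (forall A B, measurable A -> measurable B ->
    P (X @^-1` A `&` Y @^-1` B) = (P (X @^-1` A) * P (Y @^-1` B))%E) ->
  (forall B, measurable B -> distribution P Y B = D B) ->
  measurable_fun [set: T1 * T2] g -> (forall z, 0 <= g z)%E ->
  (\int[P]_w g (X w, Y w) = \int[P]_w \int[D]_y g (X w, y))%E.
Proof.
move=> indep YD mg g0.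
pose m1 : {measure set (T1 * T2) -> \bar R} := pushforward P (fun w => (X w, Y w)).
transitivity (\int[m1 measurable_pair]_z g z)%E.
  by rewrite ge0_integral_pushforward.
have m1E A : measurable A -> A `<=` setT ->
    m1 measurable_pair A = (distribution P X \x D)%E A.
  move=> mA _; apply/esym; apply: product_measure_unique => // B C mB mC.
  transitivity (distribution P X B * distribution P Y C)%E; first exact: indep.
  by congr (_ * _)%E; exact: YD.
rewrite (eq_measure_integral (distribution P X \x D)%E m1E).
rewrite fubini_tonelli1 // ge0_integral_distribution //.
- exact: measurable_fun_fubini_tonelli_F.
- by move=> x; exact: integral_ge0.
Qed.

End PairIndependence.

(** * Random recursions driven by independent directions *)

Section Recursion.
Context {disp d1 d2 : measure_display} {Omega : measurableType disp}.
Context {T1 : measurableType d1} {T2 : measurableType d2} {R : realType}.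
Variable P : probability Omega R.
Variables (s : nat -> {RV P >-> T2}) (X : nat -> Omega -> T1).
Variables (next : nat -> T1 -> T2 -> T1) (x1 : T1).
Hypothesis s_indep : mutually_independent [set t | (1 <= t)%N] s.
Hypothesis mnext : forall t, (1 <= t)%N ->
  measurable_fun [set: T1 * T2] (fun p => next t p.1 p.2).
Hypothesis X_init : forall w, X 1 w = x1.
Hypothesis X_step : forall t, (1 <= t)%N -> forall w, X t.+1 w = next t (X t w) (s t w).

Lemma measurable_recursion t : (1 <= t)%N -> measurable_fun [set: Omega] (X t).
Proof.
case: t => // t _; elim: t => [|t IH].
  by rewrite (_ : X 1 = cst x1) //; apply/funext.
rewrite (_ : X t.+2 = (fun p => next t.+1 p.1 p.2) \o (fun w => (X t.+1 w, s t.+1 w))).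
  by apply: measurableT_comp; [exact: mnext|exact: measurable_fun_pair].
by apply/funext => w; rewrite X_step.
Qed.

(** Cylinder events on finitely many directions, in the shape used by [mutually_independent]. *)
Let cyl (J : {fset nat}) (A : nat -> set T2) : set Omega :=
  \bigcap_(i in [set` J]) (s i @^-1` A i).

Let measurable_cyl J A : (forall i, measurable (A i)) -> measurable (cyl J A).
Proof.
by move=> mA; apply: bigcap_measurableType => i _; exact: measurable_funPTI.
Qed.

Let cyl_cons t J A B : t \notin J ->
  cyl (t |` J)%fset (fun i => if i == t then B else A i) = s t @^-1` B `&` cyl J A.
Proof.
move=> tJ; apply/seteqP; split => [w H|w [H1 H2] i /=]; last first.
  by rewrite !inE; case: eqVneq => [-> _ //|_ /= iJ]; exact: H2.
split; first by have := H t; rewrite /= !inE eqxx; exact.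
move=> i /= iJ; have := H i; rewrite /= !inE iJ orbT => /(_ isT).
by case: eqVneq => // it; rewrite -it iJ in tJ.
Qed.

Let cyl_indep t J A B : (1 <= t)%N -> t \notin J ->
  [set` J] `<=` [set i | (1 <= i)%N] ->
  (forall i, measurable (A i)) -> measurable B ->
  P (s t @^-1` B `&` cyl J A) = (P (s t @^-1` B) * P (cyl J A))%E.
Proof.
move=> t1 tJ J1 mA mB; rewrite -cyl_cons // !s_indep //.
- rewrite big_fsetU1 //= eqxx; congr (_ * _)%E.
  by apply: eq_big_seq => i iJ; case: eqVneq => // it; rewrite -it iJ in tJ.
- by move=> i /=; rewrite !inE => /orP[/eqP ->|/J1].
- by move=> i; case: ifP.
Qed.

(** [X t] depends only on directions before time [t]. Conditioning uses just [J = {t}], but the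
    induction on [t] needs every finite set of present and future indices, since each step moves one
    index into the cylinder. *)
Lemma recursion_independent t (J : {fset nat}) A B : (1 <= t)%N ->
  (forall i, i \in J -> (t <= i)%N) ->
  (forall i, measurable (A i)) -> measurable B ->
  P (X t @^-1` B `&` cyl J A) = (P (X t @^-1` B) * P (cyl J A))%E.
Proof.
case: t => // t _; elim: t J A B => [|t IH] J A B Jt mA mB.
  rewrite (_ : X 1 = cst x1); last exact/funext.
  rewrite preimage_cst; case: ifP => _.
    by rewrite setTI probability_setT mul1e.
  by rewrite set0I measure0 mul0e.
have mX := measurable_recursion (ltn0Sn t).
pose Xt : {RV P >-> T1} := HB.pack (X t.+1) (isMeasurableFun.Build _ _ _ _ (X t.+1) mX).
have tJ : t.+1 \notin J by apply/negP => /Jt; rewrite ltnn.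
have J1 : [set` J] `<=` [set i | (1 <= i)%N].
  by move=> i /= /Jt; exact: leq_trans.
have IH1 B1 A1 : measurable B1 -> measurable A1 ->
    P (Xt @^-1` B1 `&` s t.+1 @^-1` A1) = (P (Xt @^-1` B1) * P (s t.+1 @^-1` A1))%E.
  move=> mB1 mA1.
  have := IH [fset t.+1]%fset (fun=> A1) B1 _ (fun=> mA1) mB1.
  rewrite /cyl set_fset1 bigcap_set1; apply.
  by move=> i; rewrite inE => /eqP ->.
have pre : X t.+2 @^-1` B =
    (fun w => (Xt w, s t.+1 w)) @^-1` ((fun p => next t.+1 p.1 p.2) @^-1` B).
  by apply/seteqP; split => w /=; rewrite (X_step (ltn0Sn t)).
rewrite pre; apply: pair_independent_event; first exact: measurable_cyl.
- move=> B1 A1 mB1 mA1.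
  (* The event on the current direction joins the cylinder, the induction hypothesis separates [X],
     and independence of the directions then splits that event off again. *)
  rewrite IH1 // -setIA -cyl_cons // IH //; last 2 first.
  + by move=> i; rewrite !inE => /orP[/eqP ->//|/Jt /ltnW].
  + by move=> i; case: ifP.
  by rewrite cyl_cons // cyl_indep // muleA.
- by rewrite -[X in measurable X]setTI; exact: mnext.
Qed.

Lemma measurable_conditional_expectation (D : probability T2 R) t (g : T1 -> R) :
  (1 <= t)%N -> measurable_fun [set: T1] g -> (forall x, 0 <= g x) ->
  measurable_fun [set: Omega] (fun w => 'E_D[fun y => g (next t (X t w) y)])%E.
Proof.
move=> t1 mg g0; pose G (z : T1 * T2) := (g (next t z.1 z.2))%:E.
have mG : measurable_fun setT G.
  apply/measurable_EFinP.
  by apply: (measurableT_comp (f := g)) => //; exact: mnext.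
have -> : (fun w => 'E_D[fun y => g (next t (X t w) y)])%E = fubini_F D G \o X t.
  by apply/funext => w; rewrite expectationE.
apply: measurableT_comp; last exact: measurable_recursion.
by apply: measurable_fun_fubini_tonelli_F => // z; rewrite lee_fin.
Qed.

(** The fresh direction is independent of [X t], so it can be integrated against its law [D] with
    [X t] frozen; this is conditioning on the current iterate. *)
Lemma expectation_recursion (D : probability T2 R) t (g : T1 -> R) :
  (1 <= t)%N -> (forall A, measurable A -> distribution P (s t) A = D A) ->
  measurable_fun [set: T1] g -> (forall x, 0 <= g x) ->
  ('E_P[fun w => g (X t.+1 w)] =
     \int[P]_w 'E_D[fun y => g (next t (X t w) y)])%E.
Proof.
move=> t1 sD mg g0; have mX := measurable_recursion t1.
pose Xt : {RV P >-> T1} := HB.pack (X t) (isMeasurableFun.Build _ _ _ _ (X t) mX).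
pose G (z : T1 * T2) := (g (next t z.1 z.2))%:E.
transitivity (\int[P]_w G (Xt w, s t w))%E.
  by rewrite expectationE; apply: eq_integral => w _; rewrite X_step.
transitivity (\int[P]_w \int[D]_y G (Xt w, y))%E; last first.
  by apply: eq_integral => w _; rewrite expectationE.
apply: ge0_integral_pair => //.
- move=> B A mB mA.
  have := @recursion_independent t [fset t]%fset (fun=> A) B t1 _ (fun=> mA) mB.
  rewrite /cyl set_fset1 bigcap_set1; apply.
  by move=> i; rewrite inE => /eqP ->.
- apply/measurable_EFinP.
  by apply: (measurableT_comp (f := g)) => //; exact: mnext.
- by move=> z; rewrite lee_fin.
Qed.

End Recursion.

(** * Solution of the scalar recursion, and the convergence rate *)

Lemma geometric_recursion (R : realType) (e : nat -> \bar R) (rho h c a : R) :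
  0 < rho -> 0 < h -> 0 <= c -> 1 < h ^+ 2 * rho ->
  e 1 = a%:E ->
  (forall t, (1 <= t)%N -> e t.+1 <= rho%:E * e t + (c * (h ^- t) ^+ 2)%:E)%E ->
  forall t, (1 <= t)%N ->
    (e t <= (rho ^+ (t - 1) * (a + c * (1 / (h ^+ 2 * rho - 1))))%:E)%E.
Proof.
move=> rho0 h0 c0 q1 e1 erec [//|t] _; rewrite subn1 /=.
have qn0 : h ^+ 2 * rho != 0 by rewrite gt_eqF // (lt_trans ltr01).
have qm0 : h ^+ 2 * rho - 1 != 0 by rewrite subr_eq0 gt_eqF.
(* With [q = h^2 rho], the fraction is the sum of [q^-k] over [1 <= k <= t]. Keeping this partial
   sum exact turns the induction step into an identity; [q^-t] is dropped only afterwards. *)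
have main : (e t.+1 <= (rho ^+ t *
    (a + c * ((1 - (h ^+ 2 * rho) ^- t) / (h ^+ 2 * rho - 1))))%:E)%E.
  elim: t => [|t IH].
    by rewrite e1 expr0 invr1 subrr mul0r mulr0 addr0 mul1r.
  apply: le_trans (erec t.+1 isT) _.
  apply: le_trans (leeD2r _ (lee_wpmul2l _ IH)) _; first by rewrite lee_fin ltW.
  rewrite -EFinM -EFinD lee_fin le_eqVlt; apply/orP; left; apply/eqP.
  have hE : (h ^- t.+1) ^+ 2 = rho ^+ t.+1 * (h ^+ 2 * rho) ^- t.+1.
    rewrite exprMn invfM mulrCA divff ?mulr1 ?expf_neq0 ?gt_eqF //.
    by rewrite exprVn -!exprM mulnC.
  rewrite hE; move: (h ^+ 2 * rho) qn0 qm0 => q qn0 qm0.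
  rewrite (exprS rho) (exprS q).
  have : q ^+ t != 0 by rewrite expf_neq0.
  by move: (q ^+ t) (rho ^+ t) => Q r Q0; field; rewrite qm0 Q0.
apply: le_trans main _; rewrite lee_fin.
apply: ler_wpM2l; first by rewrite exprn_ge0 // ltW.
rewrite lerD2l; apply: ler_wpM2l => //.
apply: ler_wpM2r; first by rewrite invr_ge0 subr_ge0 ltW.
by rewrite gerBl invr_ge0 exprn_ge0 // mulr_ge0 ?sqr_ge0 // ltW.
Qed.

Theorem theorem6 (R : realType) (d : nat) (hd : (0 < d)%N)
  (f : 'rV[R]_d -> R) (L mu : R) (xstar : 'rV[R]_d)
  (f_diff : forall x, differentiable f x)
  (L_gt0 : 0 < L) (f_smooth : smooth L f)
  (mu_gt0 : 0 < mu) (f_sconvex : strongly_convex mu f)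
  (f_min : argmin f [set: 'rV[R]_d] = [set xstar])
  (D : probability 'rV[R]_d R) (muD : R)
  (D_moment : ('E_D[fun s => (norm2 s ^+ 2)%R] < +oo)%E)
  (muD_gt0 : 0 < muD)
  (D_spread : forall v, ((muD * norm2 v)%:E <= 'E_D[fun s => `|dotp v s|%R])%E)
  (D_bounded : D [set s | norm2 s <= 1] = 1%E)
  (muD_lt1 : muD < 1)
  (h : R)
  (disp : measure_display) (Omega : measurableType disp)
  (P : probability Omega R)
  (theta1 : 'rV[R]_d) (s : nat -> {RV P >-> 'rV[R]_d})
  (theta : nat -> Omega -> 'rV[R]_d)
  (theta_STP : STP f D (stepsize f L h) theta1 s theta) :
  let rho : R := 1 - muD ^+ 2 * mu / L in
  (1 / Num.sqrt rho < h ->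
    forall T : nat, (2 <= T)%N ->
      ('E_P[fun w => (f (theta T w) - f xstar)%R] <=
        (rho ^+ (T - 1) *
          (f theta1 - f xstar + L / 8 * (1 / (h ^+ 2 * rho - 1))))%:E)%E)
  /\
  (forall K : R, 0 < K -> muD = K / Num.sqrt d%:R -> h = 2 / Num.sqrt rho ->
    (fun T : nat => fine ('E_P[fun w => (f (theta T w) - f xstar)%R])%E : R^o) =O_\oo
    (fun T : nat => (1 - mu * K ^+ 2 / (d%:R * L)) ^+ T : R^o)).
Proof.
move=> rho.
have fmin x : f xstar <= f x.
  have : argmin f [set: 'rV[R]_d] xstar by rewrite f_min.
  by case=> _; exact.
have f_cont : continuous f by move=> x; exact: differentiable_continuous.
(* [muD^2 mu < mu <= L]. *)
have rho_gt0 : 0 < rho.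
  rewrite subr_gt0 ltr_pdivrMr // mul1r.
  apply: lt_le_trans (mu_le_L f_smooth f_sconvex hd).
  by rewrite gtr_pMl // expr_lt1 // ltW.
case: theta_STP => s_distr s_indep theta_init [next next_sel theta_step].
have mnext t : (1 <= t)%N -> measurable_fun setT (fun p => next t p.1 p.2).
  by move=> /next_sel[].
have mtheta t : (1 <= t)%N -> measurable_fun setT (theta t).
  exact: (measurable_recursion mnext theta_init theta_step).
pose gap x := f x - f xstar.
have gap0 x : 0 <= gap x by rewrite subr_ge0.
have mgap : measurable_fun setT gap.
  by apply: measurable_funB => //; exact: continuous_measurable_rV.
have mgapt t : (1 <= t)%N -> measurable_fun setT (gap \o theta t).
  by move=> t1; apply: measurableT_comp => //; exact: mtheta.
have step t : 0 < h -> (1 <= t)%N ->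
    ('E_P[gap \o theta t.+1] <=
     rho%:E * 'E_P[gap \o theta t] + (L / 8 * (h ^- t) ^+ 2)%:E)%E.
  move=> h0 t1.
  rewrite (expectation_recursion s_indep mnext theta_init theta_step t1
    (s_distr t t1) mgap gap0).
  have c0 : 0 <= L / 8 * (h ^- t) ^+ 2 by rewrite mulr_ge0 ?sqr_ge0 // divr_ge0 // ltW.
  apply: (@le_trans _ _
    'E_P[fun w => (rho * gap (theta t w) + L / 8 * (h ^- t) ^+ 2)%R])%E.
    rewrite expectationE; apply: ge0_le_integral => //.
    - by move=> w _; exact: expectation_ge0.
    - exact: (measurable_conditional_expectation mnext theta_init theta_step).
    - apply/measurable_EFinP; apply: measurable_funD => //.
      by apply: measurable_funM => //; exact: mgapt.
    - move=> w _; apply: le_trans (conditional_decrease f_smooth f_sconvex f_cont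
        L_gt0 mu_gt0 fmin muD_gt0 D_spread D_bounded (x := theta t w)
        (sel := next t (theta t w)) (r := h ^- t) _ _ _) _.
      + by rewrite invr_gt0 exprn_gt0.
      + exact: measurableT_comp (mnext t t1) (pair1_measurable _).
      + by move=> y; have [_] := next_sel t t1; exact.
      + by rewrite lee_fin -/rho -/(gap _) lerD2l mulrAC.
  rewrite ge0_expectationD //; last 2 first.
  - by apply: measurable_funM => //; exact: mgapt.
  - by move=> w; rewrite mulr_ge0 // ltW.
  rewrite ge0_expectationZl //; [|exact: mgapt|exact: ltW].
  by apply: leeD2l; rewrite [leLHS]expectation_cst.
(* Starting at [T = 1] also yields, further down, the sign of the constant. *)
have bound : 1 / Num.sqrt rho < h -> forall T : nat, (1 <= T)%N ->
    ('E_P[gap \o theta T] <=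
      (rho ^+ (T - 1) * (gap theta1 + L / 8 * (1 / (h ^+ 2 * rho - 1))))%:E)%E.
  move=> hrho.
  have sr0 : 0 < Num.sqrt rho by rewrite sqrtr_gt0.
  have h0 : 0 < h by apply: lt_trans hrho; rewrite divr_gt0.
  apply: geometric_recursion => //.
  - by rewrite divr_ge0 // ltW.
  (* The ratio condition [1 < h^2 rho] is the square of the assumed [1 < h sqrt(rho)]. *)
  - rewrite -[rho]sqr_sqrtr ?ltW // -exprMn expr_gt1 ?mulr_ge0 ?ltW //.
    by rewrite -ltr_pdivrMr.
  - rewrite (_ : gap \o theta 1 = cst (gap theta1)) ?expectation_cst //.
    by apply/funext => w /=; rewrite theta_init.
  - by move=> t; exact: step.
split=> [hrho T T2|K K0 muDE hE]; first exact: bound hrho T (ltnW T2).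
have hrho : 1 / Num.sqrt rho < h.
  by rewrite hE ltr_pM2r ?invr_gt0 ?sqrtr_gt0 // ltr1n.
have -> : 1 - mu * K ^+ 2 / (d%:R * L) = rho.
  rewrite /rho muDE expr_div_n sqr_sqrtr ?ler0n //.
  by congr (1 - _); field; rewrite !gt_eqF ?ltr0n.
set C := gap theta1 + L / 8 * (1 / (h ^+ 2 * rho - 1)) in bound.
have E0 T : (0 <= 'E_P[gap \o theta T])%E.
  by apply: expectation_ge0 => w; exact: gap0.
(* At [T = 1] the bound places [C] above a nonnegative expectation. *)
have C0 : 0 <= C.
  by have := le_trans (E0 1) (bound hrho 1 isT); rewrite subnn expr0 mul1r lee_fin.
(* [C / rho] absorbs the shift from [rho^(T - 1)] to [rho^T]; adding 1 makes the constant strictly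
   positive. *)
apply/eqO_exP; exists (C / rho + 1); first by rewrite ltr_pwDr // divr_ge0 // ltW.
near=> T.
have T1 : (1 <= T)%N by near: T; exact: nbhs_infty_ge.
have := bound hrho T T1; have := E0 T.
(* The two bounds exclude both infinite values, so [fine] returns the true expectation. *)
rewrite /comp /gap; case: ('E_P[_])%E => [r| |] //; rewrite !lee_fin => r0 rC /=.
rewrite (ger0_norm r0) ger0_norm ?exprn_ge0 ?(ltW rho_gt0) //.
apply: (le_trans rC); rewrite -[in leRHS](subnK T1) exprD expr1.
rewrite mulrDl mul1r [in leRHS]mulrCA divfK ?gt_eqF // lerDl.
by rewrite mulr_ge0 ?exprn_ge0 // ltW.
Unshelve. all: by end_near.
Qed.
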